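(* In a one-parameter planar homothetic hyperbolic motion $\mathbb{H}/\mathbb{H}'$, the moving pole curve $(P)$ in the plane $\mathbb{H}$ rolls by sliding on the fixed pole curve $(P')$ in the plane $\mathbb{H}'$. The coefficient of this sliding, rolling motion is the homothetic scale $h$.
   Context: Hyperbolic numbers: $\mathbb{R}[j]=\{x+jy: x,y\in\mathbb{R}\}$ with $j^2=1$, $j\neq\pm1$, with the resulting commutative multiplication; $\|x+jy\|_h=\sqrt{|x^2-y^2|}$ is the hyperbolic modulus; $e^{j\varphi}=\cosh\varphi+j\sinh\varphi$ for $\varphi\in\mathbb{R}$. One-parameter planar homothetic hyperbolic motion $\mathbb{H}/\mathbb{H}'$: $\mathbb{H}$ (moving) and $\mathbb{H}'$ (fixed) are two copies of the plane of hyperbolic numbers, each with an orthonormal coordinate system. The rotation angle $\varphi$ and the homothetic scale $h$ (real valued, $h$ not constant) and $\mathbf{u}=u_1+ju_2$ (hyperbolic-number valued, representing the origin of the fixed system in the moving system) are $C^\infty$ functions of a real parameter $t$ (time), with $\dot\varphi(t)\neq0$ during the motion, and the coordinate systems coincide at $t=0$. A point represented in $\mathbb{H}$ by $\mathbf{x}$ is represented in $\mathbb{H}'$ by $\mathbf{x}'=(h\mathbf{x}-\mathbf{u})e^{j\varphi}$. Dots denote $d/dt$. Pole curves: the sliding velocity of a point $\mathbf{x}$ is $\mathbf{V}_f=(\dot h+jh\dot\varphi)\mathbf{x}e^{j\varphi}-(\dot{\mathbf{u}}+j\mathbf{u}\dot\varphi)e^{j\varphi}$. The (rotation) pole $P$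 at time $t$ is the point at which $\mathbf{V}_f=\mathbf{0}$; in $\mathbb{H}$ it is represented by $\mathbf{p}=\dfrac{\dot{\mathbf{u}}+j\dot\varphi\mathbf{u}}{\dot h+jh\dot\varphi}$, and in $\mathbb{H}'$ by $\mathbf{p}'=(h\mathbf{p}-\mathbf{u})e^{j\varphi}$. The moving pole curve $(P)$ is the locus of the poles in $\mathbb{H}$ and the fixed pole curve $(P')$ is the locus of the poles in $\mathbb{H}'$. Terminology: ''rolls by sliding with coefficient $h$'' is understood in the following sense: the tangent vectors of the pole curves at their contact point are related by $\dot{\mathbf{p}}'=h\,\dot{\mathbf{p}}\,e^{j\varphi}$, and the arc elements $ds=\|\dot{\mathbf{p}}\|_h\,dt$ of $(P)$ and $ds'=\|\dot{\mathbf{p}}'\|_h\,dt$ of $(P')$ are related by $ds'=|h|\,ds$ (rolling without sliding being the case $ds'=ds$). *)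

(* Defs.v *)
From Stdlib Require Export Reals.
From Stdlib Require Import Lra.
From Coquelicot Require Export Coquelicot.

Set Implicit Arguments.
Unset Strict Implicit.
Unset Printing Implicit Defensive.

(* The pair [(x, y)] stands for x + jy with j^2 = 1.  [Hyp] unfolds to [R * R],
   so [is_derive] applies to curves [R -> Hyp] through Coquelicot's product
   normed module: their derivatives are taken componentwise. *)
Definition Hyp : Type := (R * R)%type.

Declare Scope hyp_scope.
Delimit Scope hyp_scope with H.
Bind Scope hyp_scope with Hyp.
Local Open Scope R_scope.

Definition RtoHyp (x : R) : Hyp := (x, 0).
Definition Hj : Hyp := (0, 1).
Definition Hplus (z w : Hyp) : Hyp := (fst z + fst w, snd z + snd w).
Definition Hopp (z : Hyp) : Hyp := (- fst z, - snd z).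
Definition Hminus (z w : Hyp) : Hyp := Hplus z (Hopp w).
Definition Hmult (z w : Hyp) : Hyp :=
  (fst z * fst w + snd z * snd w, fst z * snd w + snd z * fst w).
(* 1/(x + jy) = (x - jy)/(x^2 - y^2); a junk value when x = y or x = -y, i.e.
   on the zero divisors. *)
Definition Hinv (z : Hyp) : Hyp :=
  (fst z / (fst z ^ 2 - snd z ^ 2), - snd z / (fst z ^ 2 - snd z ^ 2)).
Definition Hdiv (z w : Hyp) : Hyp := Hmult z (Hinv w).

Notation "z + w" := (Hplus z w) : hyp_scope.
Notation "z - w" := (Hminus z w) : hyp_scope.
Notation "z * w" := (Hmult z w) : hyp_scope.
Notation "z / w" := (Hdiv z w) : hyp_scope.
Coercion RtoHyp : R >-> Hyp.

Definition Hmod (z : Hyp) : R := sqrt (Rabs (fst z ^ 2 - snd z ^ 2)).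

(* e^{j a} *)
Definition Hexpj (a : R) : Hyp := (cosh a, sinh a).

Definition smooth_on (D : R -> Prop) (f : R -> R) : Prop :=
  forall (n : nat) (t : R), D t -> ex_derive_n f n t.

(* The time interval is an arbitrary open interval around 0, possibly R. *)
Record homothetic_motion := HomotheticMotion {
  t_min : Rbar;
  t_max : Rbar;
  time := fun t : R => Rbar_lt t_min t /\ Rbar_lt t t_max;
  angle : R -> R;
  scale : R -> R;
  origin : R -> Hyp;
  time_0 : time 0;
  angle_smooth : smooth_on time angle;
  scale_smooth : smooth_on time scale;
  origin_smooth1 : smooth_on time (fun t => fst (origin t));
  origin_smooth2 : smooth_on time (fun t => snd (origin t));
  scale_not_constant : exists s t, time s /\ time t /\ scale s <> scale t;
  angle_dot_neq0 : forall t, time t -> Derive angle t <> 0;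
  (* Origins and axes agree at time 0; the scale [scale 0] is left free. *)
  angle_0 : angle 0 = 0;
  origin_0 : origin 0 = RtoHyp 0
}.

Definition angle_dot (M : homothetic_motion) (t : R) : R := Derive (angle M) t.
Definition scale_dot (M : homothetic_motion) (t : R) : R := Derive (scale M) t.
Definition origin_dot (M : homothetic_motion) (t : R) : Hyp :=
  (Derive (fun s => fst (origin M s)) t, Derive (fun s => snd (origin M s)) t).

Definition position (M : homothetic_motion) (t : R) (x : Hyp) : Hyp :=
  ((scale M t * x - origin M t) * Hexpj (angle M t))%H.

Definition pole_denominator (M : homothetic_motion) (t : R) : Hyp :=
  (scale_dot M t + Hj * scale M t * angle_dot M t)%H.

Definition sliding_velocity (M : homothetic_motion) (t : R) (x : Hyp) : Hyp :=
  (pole_denominator M t * x * Hexpj (angle M t)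
   - (origin_dot M t + Hj * origin M t * angle_dot M t) * Hexpj (angle M t))%H.

Definition has_pole (M : homothetic_motion) (t : R) : Prop :=
  exists! x : Hyp, sliding_velocity M t x = RtoHyp 0.

(* Meaningful only at the times [t] with [has_pole M t]; see [pole_spec]. *)
Definition moving_pole (M : homothetic_motion) (t : R) : Hyp :=
  ((origin_dot M t + Hj * angle_dot M t * origin M t)
   / pole_denominator M t)%H.

Definition fixed_pole (M : homothetic_motion) (t : R) : Hyp :=
  position M t (moving_pole M t).

(* At each time of [D], the curve [p] of the moving plane and the curve [p'] of
   the fixed plane are in contact, their tangent vectors [v] and [v'] satisfy
   v' = c v e^{j angle}, and their arc elements ds = Hmod v dt and
   ds' = Hmod v' dt satisfy ds' = |c| ds. *)
Definition rolls_by_sliding_on (D : R -> Prop) (M : homothetic_motion)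
    (p p' : R -> Hyp) (c : R -> R) : Prop :=
  forall t, D t ->
    p' t = position M t (p t) /\
    exists v v' : Hyp,
      is_derive p t v /\ is_derive p' t v' /\
      v' = (c t * v * Hexpj (angle M t))%H /\
      Hmod v' = Rabs (c t) * Hmod v.

Lemma Hexpj_unit (a : R) : (Hexpj a * Hexpj (- a))%H = RtoHyp 1.
Proof.
unfold Hmult, Hexpj, RtoHyp, cosh, sinh; simpl.
rewrite Ropp_involutive.
assert (E : exp a * exp (- a) = 1) by (rewrite <- exp_plus, Rplus_opp_r; apply exp_0).
f_equal; [ replace 1 with (exp a * exp (- a)) | ]; field.
Qed.

Lemma sliding_velocity_eq0 (M : homothetic_motion) (t : R) (x : Hyp) :
  sliding_velocity M t x = RtoHyp 0 <->
  (pole_denominator M t * x)%H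
  = (origin_dot M t + Hj * angle_dot M t * origin M t)%H.
Proof.
assert (A : forall z w e : Hyp, (z * e - w * e = (z - w) * e)%H).
{ intros [] [] []; unfold Hminus, Hmult, Hplus, Hopp; simpl; f_equal; ring. }
assert (B : (Hj * origin M t * angle_dot M t = Hj * angle_dot M t * origin M t)%H).
{ unfold Hmult, Hj, RtoHyp; simpl; f_equal; ring. }
unfold sliding_velocity; rewrite A, B.
generalize (pole_denominator M t * x)%H.
generalize (origin_dot M t + Hj * angle_dot M t * origin M t)%H.
intros w z; split.
- intros E.
  assert (E' : (z - w)%H = RtoHyp 0).
  { transitivity ((z - w) * Hexpj (angle M t) * Hexpj (- angle M t))%H.
    - transitivity ((z - w) * (Hexpj (angle M t) * Hexpj (- angle M t)))%H.
      + rewrite Hexpj_unit; unfold Hmult, RtoHyp; destruct (z - w)%H; simpl;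
          f_equal; ring.
      + unfold Hmult; simpl; f_equal; ring.
    - rewrite E; unfold Hmult, RtoHyp; simpl; f_equal; ring. }
  destruct z, w; unfold Hminus, Hplus, Hopp, RtoHyp in E'; simpl in E'.
  injection E' as E1 E2; f_equal; lra.
- intros ->; unfold Hminus, Hmult, Hplus, Hopp, RtoHyp; simpl; f_equal; ring.
Qed.

Lemma has_poleP (M : homothetic_motion) (t : R) :
  has_pole M t <-> Hmod (pole_denominator M t) <> 0.
Proof.
assert (N : forall d : Hyp, Hmod d <> 0 <-> fst d ^ 2 - snd d ^ 2 <> 0).
{ intros d; unfold Hmod; split; intros H E; apply H.
  - rewrite E, Rabs_R0; apply sqrt_0.
  - apply Rabs_eq_0, sqrt_eq_0; [ apply Rabs_pos | exact E ]. }
rewrite N; unfold has_pole; split.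
- intros [x [Hx Ux]] Z.
  assert (K : forall k : Hyp, (pole_denominator M t * k)%H = RtoHyp 0 ->
                k = RtoHyp 0).
  { intros k Hk.
    assert (E : x = (x + k)%H).
    { apply Ux; apply sliding_velocity_eq0.
      apply sliding_velocity_eq0 in Hx; rewrite <- Hx.
      transitivity (pole_denominator M t * x + pole_denominator M t * k)%H.
      - unfold Hmult, Hplus; simpl; f_equal; ring.
      - rewrite Hk; unfold Hmult, Hplus, RtoHyp; simpl; f_equal; ring. }
    destruct x, k; unfold Hplus in E; simpl in E; injection E as E1 E2.
    unfold RtoHyp; f_equal; lra. }
  clear x Hx Ux; revert Z K; destruct (pole_denominator M t) as [a b]; simpl.
  intros Z K.
  assert (C : (a, - b) = RtoHyp 0).
  { apply K; unfold Hmult, RtoHyp; simpl; f_equal; lra. }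
  injection C as C1 C2.
  assert (E : (1, 0) = RtoHyp 0).
  { apply K; rewrite C1; replace b with 0 by lra.
    unfold Hmult, RtoHyp; simpl; f_equal; lra. }
  injection E; lra.
- intros D; exists (moving_pole M t); unfold moving_pole; split.
  + apply sliding_velocity_eq0.
    generalize (origin_dot M t + Hj * angle_dot M t * origin M t)%H.
    generalize dependent (pole_denominator M t).
    intros [] D []; unfold Hdiv, Hmult, Hinv; simpl in *; f_equal; field; lra.
  + intros x Hx; apply sliding_velocity_eq0 in Hx; rewrite <- Hx.
    generalize dependent (pole_denominator M t).
    intros [] D _; destruct x; unfold Hdiv, Hmult, Hinv; simpl in *;
      f_equal; field; lra.
Qed.

Lemma pole_spec (M : homothetic_motion) (t : R) (x : Hyp) :
  has_pole M t ->
  (sliding_velocity M t x = RtoHyp 0 <-> x = moving_pole M t).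
Proof.
intros H.
assert (D : Hmod (pole_denominator M t) <> 0) by (apply has_poleP; exact H).
assert (Z : sliding_velocity M t (moving_pole M t) = RtoHyp 0).
{ apply sliding_velocity_eq0; unfold moving_pole.
  assert (D' : fst (pole_denominator M t) ^ 2 - snd (pole_denominator M t) ^ 2 <> 0).
  { intros E; apply D; unfold Hmod; rewrite E, Rabs_R0; apply sqrt_0. }
  clear D; generalize (origin_dot M t + Hj * angle_dot M t * origin M t)%H.
  generalize dependent (pole_denominator M t).
  intros [] D []; unfold Hdiv, Hmult, Hinv; simpl in *; f_equal; field; lra. }
destruct H as [y [_ U]]; split.
- intros E; rewrite <- (U _ E); exact (U _ Z).
- intros ->; exact Z.
Qed.

Lemma is_derive_Hyp (f : R -> Hyp) (t : R) (v : Hyp) :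
  is_derive (fun s => fst (f s)) t (fst v) ->
  is_derive (fun s => snd (f s)) t (snd v) ->
  is_derive f t v.
Proof.
intros H1 H2.
apply is_derive_ext with (fun s => (fst (f s), snd (f s)) : Hyp).
{ intros s; destruct (f s); reflexivity. }
destruct v as [v1 v2].
apply (filterdiff_comp'_2 (fun s => fst (f s)) (fun s => snd (f s))
         (fun a b => (a, b) : Hyp) _ _ _ (fun a b => (a, b) : Hyp) H1 H2).
apply filterdiff_ext_lin with (fun z : R * R => z).
2: { intros []; reflexivity. }
apply filterdiff_ext with (fun z : R * R => z).
{ intros []; reflexivity. }
apply filterdiff_id.
Qed.

(* The sliding velocity is the velocity in the fixed plane of a point that is
   fixed in the moving plane. *)
Lemma sliding_velocityE (M : homothetic_motion) (t : R) (x : Hyp) :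
  time M t ->
  is_derive (fun s => position M s x) t (sliding_velocity M t x).
Proof.
intros T.
pose proof (@angle_smooth M 1%nat t T) as Dp.
pose proof (@scale_smooth M 1%nat t T) as Ds.
pose proof (@origin_smooth1 M 1%nat t T) as D1.
pose proof (@origin_smooth2 M 1%nat t T) as D2.
simpl in Dp, Ds, D1, D2.
revert Dp Ds D1 D2.
unfold position, sliding_velocity, pole_denominator, angle_dot, scale_dot,
  origin_dot, Hexpj, Hminus, Hmult, Hplus, Hopp, RtoHyp, Hj, cosh, sinh; simpl.
set (u1 := fun s => fst (origin M s)); set (u2 := fun s => snd (origin M s)).
change (fst (origin M t)) with (u1 t); change (snd (origin M t)) with (u2 t).
intros Dp Ds D1 D2; apply is_derive_Hyp; simpl.
- apply is_derive_ext with (fun s =>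
    (scale M s * fst x + 0 * snd x + - u1 s)
      * ((exp (angle M s) + exp (- angle M s)) / 2)
    + (scale M s * snd x + 0 * fst x + - u2 s)
      * ((exp (angle M s) - exp (- angle M s)) / 2)); [ reflexivity | ].
  clearbody u1 u2; auto_derive; [ repeat split; auto | ].
  change (fun s => u1 s) with u1; change (fun s => u2 s) with u2.
  change (fun s => scale M s) with (scale M).
  change (fun s => angle M s) with (angle M); field.
- apply is_derive_ext with (fun s =>
    (scale M s * fst x + 0 * snd x + - u1 s)
      * ((exp (angle M s) - exp (- angle M s)) / 2)
    + (scale M s * snd x + 0 * fst x + - u2 s)
      * ((exp (angle M s) + exp (- angle M s)) / 2)); [ reflexivity | ].
  clearbody u1 u2; auto_derive; [ repeat split; auto | ].
  change (fun s => u1 s) with u1; change (fun s => u2 s) with u2.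
  change (fun s => scale M s) with (scale M).
  change (fun s => angle M s) with (angle M); field.
Qed.

(* Main.v *)
(* Write p' = (h p - u) e^{j phi} with p moving along the pole curve.  By the
   Leibniz rule its derivative is the sliding velocity of the point frozen at p,
   plus h (dp/dt) e^{j phi}.  The first summand vanishes by definition of the
   pole, and the arc elements are compared through the multiplicativity of the
   hyperbolic modulus and the fact that e^{j phi} has modulus 1. *)
Require Import Defs.

Set Implicit Arguments.
Unset Strict Implicit.
Unset Printing Implicit Defensive.

Local Open Scope R_scope.

Lemma Hplus_0_l (z : Hyp) : (RtoHyp 0 + z)%H = z.
Proof. destruct z; unfold Hplus, RtoHyp; simpl; f_equal; ring. Qed.

(** The quadratic form $x^2 - y^2$ is multiplicative for the hyperbolic product; the absolute value
    and the square root preserve this. *)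
Lemma Hmod_mult (z w : Hyp) : Hmod (z * w)%H = Hmod z * Hmod w.
Proof.
unfold Hmod; rewrite <- sqrt_mult by apply Rabs_pos.
rewrite <- Rabs_mult; do 2 f_equal; unfold Hmult; simpl; ring.
Qed.

Lemma Hmod_RtoHyp (x : R) : Hmod (RtoHyp x) = Rabs x.
Proof.
unfold Hmod, RtoHyp; simpl.
replace (x * (x * 1) - 0 * (0 * 1)) with (Rsqr x) by (unfold Rsqr; ring).
now rewrite (Rabs_pos_eq _ (Rle_0_sqr x)), sqrt_Rsqr_abs.
Qed.

(** Here $\cosh^2 a - \sinh^2 a$ collapses to $e^a e^{-a} = 1$. *)
Lemma Hmod_Hexpj (a : R) : Hmod (Hexpj a) = 1.
Proof.
unfold Hmod, Hexpj, cosh, sinh; simpl.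
assert (E : exp a * exp (- a) = 1)
  by (rewrite <- exp_plus, Rplus_opp_r; apply exp_0).
replace (_ - _) with (exp a * exp (- a)) by field.
now rewrite E, Rabs_R1, sqrt_1.
Qed.

Lemma is_derive_Hyp_fst (f : R -> Hyp) (t : R) (v : Hyp) :
  is_derive f t v -> is_derive (fun s => fst (f s)) t (fst v).
Proof.
intros H; apply (filterdiff_comp' f fst t (fun y => scal y v) fst H).
apply filterdiff_linear, is_linear_fst.
Qed.

Lemma is_derive_Hyp_snd (f : R -> Hyp) (t : R) (v : Hyp) :
  is_derive f t v -> is_derive (fun s => snd (f s)) t (snd v).
Proof.
intros H; apply (filterdiff_comp' f snd t (fun y => scal y v) snd H).
apply filterdiff_linear, is_linear_snd.
Qed.

Lemma ex_derive_Hyp (f : R -> Hyp) (t : R) :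
  ex_derive (fun s => fst (f s)) t -> ex_derive (fun s => snd (f s)) t ->
  ex_derive f t.
Proof.
intros [a Ha] [b Hb]; exists ((a, b) : Hyp); now apply is_derive_Hyp.
Qed.

(** [Hplus] is convertible to the addition of the product module on [R * R], so the general sum rule
    applies as it stands. *)
Lemma is_derive_Hplus (f g : R -> Hyp) (t : R) (v w : Hyp) :
  is_derive f t v -> is_derive g t w ->
  is_derive (fun s => (f s + g s)%H) t (v + w)%H.
Proof. exact (is_derive_plus f g t v w). Qed.

Lemma is_derive_Hmult (f g : R -> Hyp) (t : R) (v w : Hyp) :
  is_derive f t v -> is_derive g t w ->
  is_derive (fun s => (f s * g s)%H) t (v * g t + f t * w)%H.
Proof.
intros Hf Hg.
pose proof (is_derive_Hyp_fst Hf) as F1; pose proof (is_derive_Hyp_snd Hf) as F2.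
pose proof (is_derive_Hyp_fst Hg) as G1; pose proof (is_derive_Hyp_snd Hg) as G2.
(* Both components of a hyperbolic product have the shape $ab + cd$, so this one real Leibniz rule
   serves for each of them. *)
assert (P : forall (a b c d : R -> R) (a' b' c' d' : R),
  is_derive a t a' -> is_derive b t b' -> is_derive c t c' -> is_derive d t d' ->
  is_derive (fun s => a s * b s + c s * d s) t
    (a' * b t + c' * d t + (a t * b' + c t * d'))).
{ intros a b c d a' b' c' d' Ha Hb Hc Hd; auto_derive.
  - repeat split; eexists; eassumption.
  - change (fun s => a s) with a; change (fun s => b s) with b.
    change (fun s => c s) with c; change (fun s => d s) with d.
    rewrite (is_derive_unique _ _ _ Ha), (is_derive_unique _ _ _ Hb).
    rewrite (is_derive_unique _ _ _ Hc), (is_derive_unique _ _ _ Hd); ring. }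
apply is_derive_Hyp; [ exact (P _ _ _ _ _ _ _ _ F1 G1 F2 G2) | ].
unfold Hplus, Hmult; simpl; exact (P _ _ _ _ _ _ _ _ F1 G2 F2 G1).
Qed.

Lemma ex_derive_Hplus (f g : R -> Hyp) (t : R) :
  ex_derive f t -> ex_derive g t -> ex_derive (fun s => (f s + g s)%H) t.
Proof. intros [v Hv] [w Hw]; eexists; exact (is_derive_Hplus Hv Hw). Qed.

Lemma ex_derive_Hmult (f g : R -> Hyp) (t : R) :
  ex_derive f t -> ex_derive g t -> ex_derive (fun s => (f s * g s)%H) t.
Proof. intros [v Hv] [w Hw]; eexists; exact (is_derive_Hmult Hv Hw). Qed.

Lemma ex_derive_RtoHyp (f : R -> R) (t : R) :
  ex_derive f t -> ex_derive (fun s => RtoHyp (f s)) t.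
Proof.
intros H; apply ex_derive_Hyp; [ exact H | exact (ex_derive_const 0 t) ].
Qed.

(** A nonzero modulus keeps [f t] off the zero divisors, so both components of the inverse are real
    quotients with the same denominator, nonzero at [t]. *)
Lemma ex_derive_Hinv (f : R -> Hyp) (t : R) :
  ex_derive f t -> Hmod (f t) <> 0 -> ex_derive (fun s => Hinv (f s)) t.
Proof.
intros [v Hv] N.
assert (N' : fst (f t) ^ 2 - snd (f t) ^ 2 <> 0).
{ intros E; apply N; unfold Hmod; rewrite E, Rabs_R0; apply sqrt_0. }
assert (F1 : ex_derive (fun s => fst (f s)) t)
  by (eexists; exact (is_derive_Hyp_fst Hv)).
assert (F2 : ex_derive (fun s => snd (f s)) t)
  by (eexists; exact (is_derive_Hyp_snd Hv)).
assert (D : ex_derive (fun s => fst (f s) ^ 2 - snd (f s) ^ 2) t).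
{ apply (ex_derive_minus (V := R_NormedModule)); apply ex_derive_pow; assumption. }
apply ex_derive_Hyp; apply ex_derive_div; try assumption.
now apply (ex_derive_opp (V := R_NormedModule)).
Qed.

Lemma ex_derive_Hexpj (f : R -> R) (t : R) :
  ex_derive f t -> ex_derive (fun s => Hexpj (f s)) t.
Proof.
intros H; apply ex_derive_Hyp; unfold Hexpj, cosh, sinh; simpl;
  auto_derive; auto.
Qed.

(** The pole is a quotient built from the motion and its first derivatives, so smoothness of order
    two suffices; [has_pole] makes the denominator invertible. *)
Lemma ex_derive_moving_pole (M : homothetic_motion) (t : R) :
  time M t -> has_pole M t -> ex_derive (moving_pole M) t.
Proof.
intros T P; apply has_poleP in P.
(* [ex_derive_n] at order 2 unfolds to differentiability of the first derivative. *)
assert (A : ex_derive (fun s => RtoHyp (angle_dot M s)) t)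
  by exact (ex_derive_RtoHyp (@angle_smooth M 2%nat t T)).
assert (S : ex_derive (fun s => RtoHyp (scale M s)) t)
  by exact (ex_derive_RtoHyp (@scale_smooth M 1%nat t T)).
assert (S' : ex_derive (fun s => RtoHyp (scale_dot M s)) t)
  by exact (ex_derive_RtoHyp (@scale_smooth M 2%nat t T)).
assert (U : ex_derive (origin M) t)
  by exact (ex_derive_Hyp (@origin_smooth1 M 1%nat t T)
              (@origin_smooth2 M 1%nat t T)).
assert (U' : ex_derive (origin_dot M) t)
  by exact (@ex_derive_Hyp (origin_dot M) t (@origin_smooth1 M 2%nat t T)
              (@origin_smooth2 M 2%nat t T)).
assert (J : ex_derive (fun _ : R => Hj) t) by exact (ex_derive_const Hj t).
apply (ex_derive_Hmult (g := fun s => Hinv (pole_denominator M s))).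
- apply ex_derive_Hplus; [ exact U' | ].
  apply ex_derive_Hmult; [ | exact U ].
  now apply ex_derive_Hmult.
- apply ex_derive_Hinv; [ | exact P ].
  apply ex_derive_Hplus; [ exact S' | ].
  apply ex_derive_Hmult; [ | exact A ].
  now apply ex_derive_Hmult.
Qed.

Lemma is_derive_position (M : homothetic_motion) (x : R -> Hyp) (t : R) (v : Hyp) :
  time M t -> is_derive x t v ->
  is_derive (fun s => position M s (x s)) t
    (sliding_velocity M t (x t) + scale M t * v * Hexpj (angle M t))%H.
Proof.
intros T Hx.
destruct (ex_derive_Hmult (ex_derive_RtoHyp (@scale_smooth M 1%nat t T))
            (ex_derive_Hexpj (@angle_smooth M 1%nat t T))) as [a Ha].
assert (Hd : is_derive (fun s => (x s + Hopp (x t))%H) t (v + RtoHyp 0)%H)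
  by (apply is_derive_Hplus; [ exact Hx | exact (is_derive_const (Hopp (x t)) t) ]).
pose proof (is_derive_Hplus (sliding_velocityE (x t) T) (is_derive_Hmult Ha Hd)) as H.
(* The unknown derivative [a] of h e^{j phi} disappears, being multiplied by
   [x t - x t]. *)
replace (_ + scale M t * v * _)%H with
  (sliding_velocity M t (x t)
   + (a * (x t + Hopp (x t))
      + scale M t * Hexpj (angle M t) * (v + RtoHyp 0)))%H
  by (unfold Hplus, Hmult, Hopp, RtoHyp; simpl; f_equal; ring).
refine (is_derive_ext _ _ _ _ _ H); intros s.
unfold position, Hminus, Hplus, Hmult, Hopp, RtoHyp; simpl; f_equal; ring.
Qed.

Theorem theorem1 (M : homothetic_motion) :
  rolls_by_sliding_on (fun t : R => time M t /\ has_pole M t)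
    M (moving_pole M) (fixed_pole M) (scale M).
Proof.
(* Contact of the two curves is the definition of [fixed_pole]. *)
intros t [T P]; split; [ reflexivity | ].
destruct (ex_derive_moving_pole T P) as [v Hv].
exists v, (scale M t * v * Hexpj (angle M t))%H; split; [ | split; [ | split; [ reflexivity | ] ] ].
- exact Hv.
- pose proof (is_derive_position T Hv) as H.
  (* At the pole the sliding term is zero, which leaves only $h \dot p e^{j\varphi}$. *)
  rewrite (proj2 (pole_spec (moving_pole M t) P) eq_refl) in H.
  rewrite Hplus_0_l in H; exact H.
- now rewrite !Hmod_mult, Hmod_RtoHyp, Hmod_Hexpj, Rmult_1_r.
Qed.
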